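(* Let $R$ be an abelian, Artinian $*$-ring with unity such that the involution $*$ is proper and $\Gamma'(R)$ contains at least three vertices. Then $\Gamma'(R)$ is a star graph if and only if $R=\mathbb{Z}_2\oplus D$, where $D$ is an integral domain with involution $*$.
   Context: A $*$-ring is a ring $R$ with a map $*:R\to R$ (an involution) satisfying $(x+y)^*=x^*+y^*$, $(xy)^*=y^*x^*$ and $(x^* )^*=x$ for all $x,y\in R$. The involution is proper if $xx^*=0$ implies $x=0$. A projection is an element $e\in R$ with $e^2=e=e^*$; a $*$-ring is abelian if all its projections are central. $Z^*(R)$ denotes the set of all non-zero zero-divisors of $R$ (left or right). The generalized zero-divisor graph $\Gamma'(R)$ is the simple undirected graph with vertex set $Z^*(R)$ in which two distinct vertices $x,y$ are adjacent if and only if $x^ny^*=0$ or $y^nx^*=0$ for some positive integer $n$. A star graph is a graph with a vertex (the center) adjacent to all other vertices and with no other edges.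
   Formalization: ''Integral domain'' is read as a nonzero ring without zero-divisors, not necessarily commutative; with commutative D the claim fails for Z_2 ⊕ H, where H is the quaternions with conjugation. *)

(* Defs.v *)
From HB Require Import structures.
From mathcomp Require Import all_boot all_order all_algebra.
From mathcomp Require Import boolp classical_sets.
Set Implicit Arguments.
Unset Strict Implicit.
Unset Printing Implicit Defensive.
Import GRing.Theory.
Local Open Scope classical_set_scope.
Local Open Scope ring_scope.

(* Rings are unital and not assumed commutative; since the zero ring is not
   excluded by the phrase "ring with unity", pzRingType is used. *)

Section StarRings.
Variables (R : pzRingType) (star : R -> R).

Record star_ring : Prop := StarRing {
  starD : {morph star : x y / x + y};
  starM : {morph star : x y / x * y >-> y * x};
  starK : involutive star
}.

Definition proper_star : Prop := forall x : R, x * star x = 0 -> x = 0.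

Definition projection (e : R) : Prop := e ^+ 2 = e /\ e = star e.

Definition abelian_star : Prop :=
  forall e : R, projection e -> forall x : R, GRing.comm e x.

End StarRings.

Section Artinian.
Variable R : pzRingType.

(* The ideals of ring_quotient.v are proper and boolean; here arbitrary
   one-sided ideals, as Prop-valued sets, are needed. *)
Definition left_ideal (I : set R) : Prop :=
  [/\ I 0, forall x y, I x -> I y -> I (x - y)
    & forall a x, I x -> I (a * x)].

Definition right_ideal (I : set R) : Prop :=
  [/\ I 0, forall x y, I x -> I y -> I (x - y)
    & forall a x, I x -> I (x * a)].

Definition descending_chain_condition (P : set R -> Prop) : Prop :=
  forall I : nat -> set R,
    (forall n, P (I n)) -> (forall n, I n.+1 `<=` I n) ->
    exists N : nat, forall n : nat, (N <= n)%N -> I n = I N.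

Definition artinian : Prop :=
  descending_chain_condition left_ideal /\
  descending_chain_condition right_ideal.

End Artinian.

Record sgraph (T : Type) := SGraph {
  vertices : set T;
  adj : T -> T -> Prop;
  adj_vertices : forall x y, adj x y -> vertices x /\ vertices y;
  adj_sym : forall x y, adj x y -> adj y x;
  adj_irrefl : forall x, ~ adj x x
}.

Definition at_least_three_vertices (T : Type) (G : sgraph T) : Prop :=
  exists x y z : T, [/\ vertices G x, vertices G y & vertices G z] /\
    [/\ x <> y, x <> z & y <> z].

Definition star_graph (T : Type) (G : sgraph T) : Prop :=
  exists c : T,
    [/\ vertices G c,
        forall x, vertices G x -> x <> c -> adj G c x
      & forall x y, adj G x y -> x = c \/ y = c].

Section ZeroDivisorGraph.
Variables (R : pzRingType) (star : R -> R).

Definition left_zero_divisor (x : R) : Prop :=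
  exists y : R, y <> 0 /\ x * y = 0.

Definition right_zero_divisor (x : R) : Prop :=
  exists y : R, y <> 0 /\ y * x = 0.

Definition nonzero_zero_divisors : set R :=
  [set x | x <> 0 /\ (left_zero_divisor x \/ right_zero_divisor x)].

Definition gzd_adj (x y : R) : Prop :=
  [/\ nonzero_zero_divisors x, nonzero_zero_divisors y, x <> y
    & exists n : nat, (0 < n)%N /\
        (x ^+ n * star y = 0 \/ y ^+ n * star x = 0)].

Lemma gzd_adj_vertices x y :
  gzd_adj x y -> nonzero_zero_divisors x /\ nonzero_zero_divisors y.
Proof. by case. Qed.

Lemma gzd_adj_sym x y : gzd_adj x y -> gzd_adj y x.
Proof.
case=> hx hy xy [n [n0 h]]; split=> //; first by move=> yx; apply: xy.
by exists n; split=> //; case: h; [right|left].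
Qed.

Lemma gzd_adj_irrefl x : ~ gzd_adj x x.
Proof. by case=> _ _ /(_ erefl). Qed.

Definition gzd_graph : sgraph R :=
  SGraph gzd_adj_vertices gzd_adj_sym gzd_adj_irrefl.

End ZeroDivisorGraph.

(* No commutativity: for the quaternions H, the ring Z_2 (+) H satisfies all the
   hypotheses of the theorem and has a star graph, so "integral domain" has to
   be read as "nontrivial ring without zero-divisors". *)
Definition integral_domain (D : nzRingType) : Prop :=
  forall x y : D, x * y = 0 -> x = 0 \/ y = 0.

Definition prod_star (A B : pzRingType) (sA : A -> A) (sB : B -> B)
  (p : A * B) : A * B := (sA p.1, sB p.2).

Definition star_isomorphic (A B : pzRingType) (sA : A -> A) (sB : B -> B)
  : Prop :=
  exists f : {rmorphism A -> B},
    bijective f /\ {morph f : x / sA x >-> sB x}.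

(* Main.v *)
(* Properness and the descending chain of left ideals [R (x x^* )^n] give each
   [x] a support: a projection [e], central since [R] is abelian, with [e x = x] and
   [e] in [x R] and in [R x].  If the graph is a star with center [c], the
   support [e] of [c] is non-trivial, so [e] and [1 - e] are adjacent and [c] is
   one of them.  Write [c] for this projection: every non-zero element of [c R]
   is adjacent to [1 - c], hence equals [c], and a product that vanishes in
   [(1 - c) R] would give, up to [*], an edge avoiding [c]. *)
Require Import Defs.
From HB Require Import structures.
From mathcomp Require Import all_boot all_order all_algebra.
From mathcomp Require Import boolp classical_sets.
Set Implicit Arguments.
Unset Strict Implicit.
Unset Printing Implicit Defensive.
Import GRing.Theory.
Local Open Scope ring_scope.

(** * Corner rings of central idempotents *)

Record central_idempotent (R : pzRingType) := CentralIdempotent {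
  ci_val :> R;
  ci_idem : ci_val * ci_val = ci_val;
  ci_central : forall x, ci_val * x = x * ci_val;
  ci_neq0 : ci_val <> 0
}.

Section Corner.
Variables (R : pzRingType) (e : central_idempotent R).

(** Membership in [e R] is put as a fixed-point equation so that it is a boolean test: the corner is
    then a subtype and inherits its additive group. Its unit is [e], not [1], so the multiplicative
    laws are supplied by hand. *)
Definition corner_pred : pred R := fun x => (e : R) * x == x.

Lemma corner_pred_zmod : zmod_closed corner_pred.
Proof.
split=> [|x y]; rewrite !unfold_in ?mulr0 // => /eqP hx /eqP hy.
by rewrite mulrBr hx hy.
Qed.

HB.instance Definition _ :=
  GRing.isZmodClosed.Build R corner_pred corner_pred_zmod.

Definition corner : Type := {x : R | corner_pred x}.

HB.instance Definition _ := SubChoice.on corner.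
HB.instance Definition _ := [SubChoice_isSubZmodule of corner by <:].

Lemma cornerP (x : corner) : (e : R) * val x = val x.
Proof. exact/eqP/(valP x). Qed.

Lemma corner_mem (x : R) : corner_pred ((e : R) * x).
Proof. by rewrite /corner_pred mulrA ci_idem. Qed.

Definition corner_proj (x : R) : corner := Sub ((e : R) * x) (corner_mem x).

Definition corner_mul (x y : corner) : corner := corner_proj (val x * val y).

Lemma val_corner_proj x : val (corner_proj x) = (e : R) * x.
Proof. by rewrite SubK. Qed.

Lemma val_corner_mul x y : val (corner_mul x y) = val x * val y.
Proof. by rewrite val_corner_proj mulrA cornerP. Qed.

Lemma val_cornerD (x y : corner) : val (x + y) = val x + val y.
Proof. exact: raddfD. Qed.

Fact corner_mulA : associative corner_mul.
Proof. by move=> x y z; apply: val_inj; rewrite !val_corner_mul mulrA. Qed.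

Fact corner_mul1 : left_id (corner_proj 1) corner_mul.
Proof.
move=> x; apply: val_inj.
by rewrite val_corner_mul val_corner_proj mulr1 cornerP.
Qed.

Fact corner_mulr1 : right_id (corner_proj 1) corner_mul.
Proof.
move=> x; apply: val_inj.
by rewrite val_corner_mul val_corner_proj mulr1 -ci_central cornerP.
Qed.

Fact corner_mulDl : left_distributive corner_mul +%R.
Proof.
by move=> x y z; apply: val_inj; rewrite !(val_corner_mul, val_cornerD) mulrDl.
Qed.

Fact corner_mulDr : right_distributive corner_mul +%R.
Proof.
by move=> x y z; apply: val_inj; rewrite !(val_corner_mul, val_cornerD) mulrDr.
Qed.

Fact corner_1neq0 : corner_proj 1 != 0.
Proof.
apply/eqP => /(congr1 val); rewrite val_corner_proj mulr1; exact: ci_neq0.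
Qed.

HB.instance Definition _ := GRing.Zmodule_isNzRing.Build corner
  corner_mulA corner_mul1 corner_mulr1 corner_mulDl corner_mulDr corner_1neq0.

Lemma val_cornerM (x y : corner) : val (x * y) = val x * val y.
Proof. exact: val_corner_mul. Qed.

Lemma corner_projB : {morph corner_proj : x y / x - y}.
Proof.
move=> x y; apply: val_inj.
by rewrite (raddfB (\val : corner -> R)) !val_corner_proj mulrBr.
Qed.

Lemma corner_projM : {morph corner_proj : x y / x * y}.
Proof.
move=> x y; apply: val_inj; rewrite val_cornerM !val_corner_proj.
by rewrite -mulrA [x * (_ * y)]mulrA -ci_central !mulrA ci_idem.
Qed.

End Corner.

(** * Supports in Artinian rings with a proper involution *)

Section StarRing.
Variables (R : pzRingType) (star : R -> R).
Hypothesis hstar : star_ring star.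

Let sD := starD hstar.
Let sM := starM hstar.
Let sK := starK hstar.

Lemma star0 : star 0 = 0.
Proof. by apply: (addrI (star 0)); rewrite -sD !addr0. Qed.

Lemma star_eq0 x : star x = 0 -> x = 0.
Proof. by move=> h; rewrite -[x]sK h star0. Qed.

Lemma starN x : star (- x) = - star x.
Proof. by apply: (addrI (star x)); rewrite -sD !subrr star0. Qed.

Lemma star1 : star 1 = 1.
Proof. by rewrite -[LHS]mulr1 -[X in _ * X]sK -sM mulr1 sK. Qed.

Lemma projectionC e : projection star e -> projection star (1 - e).
Proof.
case; rewrite expr2 => ee es; split; last by rewrite sD starN star1 -es.
by rewrite expr2 mulrBr mulr1 mulrBl mul1r ee subrr subr0.
Qed.

Lemma starX x n : star (x ^+ n) = star x ^+ n.
Proof.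
by elim: n => [|n IHn]; rewrite ?star1 // exprS sM IHn -exprSr.
Qed.

(** With [w = z * y ^+ n.+1], the product [w * star w] has the left factor [z * y ^+ n.+2], so
    properness lowers the exponent one step at a time. *)
Lemma proper_mul_self_adjoint z y n : proper_star star -> star y = y ->
  z * y ^+ n.+1 = 0 -> z * y = 0.
Proof.
move=> hp ys; elim: n => [|n IHn]; first by rewrite expr1.
move=> h; apply: IHn; apply: hp.
have yy : y ^+ n.+1 * y ^+ n.+1 = y ^+ n.+2 * y ^+ n.
  by rewrite -!exprD addnS.
rewrite sM starX ys -mulrA [y ^+ n.+1 * _]mulrA yy -(mulrA (y ^+ n.+2)).
by rewrite (mulrA z) h mul0r.
Qed.

Lemma artinian_power_stable (y : R) : artinian R ->
  exists n a, y ^+ n = a * y ^+ n.+1.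
Proof.
case=> + _.
move=> /(_ (fun n => [set z | exists a, z = a * y ^+ n]%classic)) [n|n|N hN].
- split=> [|_ _ [a ->] [b ->]|b _ [a ->]].
  + by exists 0; rewrite mul0r.
  + by exists (a - b); rewrite mulrBl.
  + by exists (b * a); rewrite mulrA.
- by move=> _ [a ->]; exists (a * y); rewrite -mulrA -exprS.
- have : [set z | exists a, z = a * y ^+ N]%classic (y ^+ N).
    by exists 1; rewrite mul1r.
  by rewrite -(hN N.+1 (leqnSn N)) => -[a ha]; exists N, a.
Qed.

(** The support is [a * y], where [y = x * star x] and [y ^+ n = a * y ^+ n.+1]; cancelling powers
    of the self-adjoint [y] gives [a * y * y = y]. *)
Lemma left_support x : artinian R -> proper_star star ->
  exists e b, [/\ projection star e, e * x = x & e = x * b].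
Proof.
move=> hA hP; have [y ey] : exists y, y = x * star x by exists (x * star x).
have ys : star y = y by rewrite ey sM sK.
have [n [a ha]] := artinian_power_stable y hA.
have ay : a * y * y = y.
  have : (1 - a * y) * y = 0.
    apply: (@proper_mul_self_adjoint _ _ n hP ys).
    rewrite mulrBl mul1r -mulrA -exprS [y ^+ n.+2]exprSr mulrA -ha.
    by rewrite -exprSr subrr.
  by rewrite mulrBl mul1r => /subr0_eq.
(* The adjoint of [a * y * y = y], substituted into [a * y], turns it into [y * star a]; this makes
   [a * y] self-adjoint and idempotent. *)
have ya : y * (y * star a) = y by have := congr1 star ay; rewrite !sM ys.
have aya : a * y = y * star a by rewrite -{1}ya !mulrA ay.
have es : star (a * y) = a * y by rewrite sM ys -aya.
have ee : a * y * (a * y) = a * y by rewrite {2}aya mulrA ay -aya.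
exists (a * y), (star x * star a); split.
- by split; rewrite ?es // expr2 ee.
(* For [w = (1 - a * y) * x], the product [w * star w] begins with [(1 - a * y) * y], which
   vanishes. *)
- have : (1 - a * y) * x = 0.
    apply: hP; rewrite sM mulrA -[_ * x * star x]mulrA -ey.
    by rewrite [_ * y]mulrBl mul1r ay subrr mul0r.
  by rewrite mulrBl mul1r => /subr0_eq.
- by rewrite aya ey mulrA.
Qed.

(** The left supports of [x] and [star x] give [e] in [x R] and [f] in [R x]; since both are
    central, [f * e] equals [f] and also [e]. *)
Lemma support x : abelian_star star -> artinian R -> proper_star star ->
  exists e a b, [/\ projection star e, e * x = x, e = a * x & e = x * b].
Proof.
move=> hAb hA hP.
have [e [b [he ex eb]]] := left_support x hA hP.
have [f [a [hf fx fa]]] := left_support (star x) hA hP.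
have sf : star f = f by case: hf.
have {}fa : f = star a * x by rewrite -sf fa sM sK.
have {}fx : x * f = x by rewrite -sf -[x]sK -sM fx.
have fe : f = e.
  transitivity (f * e); first by rewrite fa -mulrA -(hAb e he x) ex.
  by rewrite (hAb f hf e) eb -mulrA -(hAb f hf b) mulrA fx.
by exists e, (star a), b; split=> //; rewrite -fe.
Qed.

End StarRing.

(** * From a star graph to a central projection *)

Section StarGraph.
Variables (R : pzRingType) (star : R -> R).
Hypotheses (hstar : star_ring star) (hproper : proper_star star).

Lemma gzd_adj_orthogonal (x y : R) : x <> 0 -> y <> 0 -> x <> y ->
  x * star y = 0 -> gzd_adj star x y.
Proof.
move=> x0 y0 xy h; split=> //.
- by split=> //; left; exists (star y); split=> // /(star_eq0 hstar).
- split=> //; left; exists (star x); split=> [/(star_eq0 hstar) //|].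
  by rewrite -[y](starK hstar) -(starM hstar) h (star0 hstar).
- by exists 1; split=> //; left; rewrite expr1.
Qed.

Lemma star_graph_center_projection :
  abelian_star star -> artinian R -> star_graph (gzd_graph star) ->
  exists c, [/\ projection star c, c <> 0, 1 - c <> 0
    & forall x y, gzd_adj star x y -> x = c \/ y = c].
Proof.
move=> hAb hA [c [[c0 cZ] _ hc]].
have [e [a [b [he ec ea eb]]]] := support hstar c hAb hA hproper.
have e0 : e <> 0 by move=> e0; apply: c0; rewrite -ec e0 mul0r.
(* If [e = 1], then [a] and [b] are one-sided inverses of [c], which contradicts that [c] is a
   zero-divisor. *)
have f0 : 1 - e <> 0.
  move=> /subr0_eq e1; case: cZ => -[w [w0 h]]; apply: w0.
    by rewrite -[w]mul1r e1 ea -mulrA h mulr0.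
  by rewrite -[w]mulr1 e1 eb mulrA h mul0r.
have hf := projectionC hstar he.
have ee : e * e = e by rewrite -expr2; case: he.
have ef : e * (1 - e) = 0 by rewrite mulrBr mulr1 ee subrr.
have e_neq : e <> 1 - e by move=> E; apply: e0; rewrite -ee {2}E.
have fs : star (1 - e) = 1 - e by case: hf.
have [|E|E] := hc e (1 - e).
  by apply: gzd_adj_orthogonal => //; rewrite fs.
- by exists e; split=> // x y; rewrite E; apply: hc.
- exists (1 - e); split=> //; first by rewrite subKr.
  by move=> x y; rewrite E; apply: hc.
Qed.

(** * Splitting the ring along the center of the star *)

Section Decomposition.
Variable c : R.
Hypotheses (cP : projection star c) (c0 : c <> 0) (d0 : 1 - c <> 0).
Hypothesis cC : forall x, c * x = x * c.
Hypothesis hc : forall x y, gzd_adj star x y -> x = c \/ y = c.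

Let cc : c * c = c. Proof. by rewrite -expr2; case: cP. Qed.
Let cs : star c = c. Proof. by case: cP. Qed.
Let ds : star (1 - c) = 1 - c. Proof. by case: (projectionC hstar cP). Qed.
Let cd : c * (1 - c) = 0. Proof. by rewrite mulrBr mulr1 cc subrr. Qed.
Let dd : (1 - c) * (1 - c) = 1 - c.
Proof. by rewrite -expr2; case: (projectionC hstar cP). Qed.
Let dC x : (1 - c) * x = x * (1 - c).
Proof. by rewrite mulrBl mulrBr mul1r mulr1 cC. Qed.

Definition cocentral : central_idempotent R := CentralIdempotent dd dC d0.

(** This is the source of the factor ['Z_2]. The edge from a non-zero [c * x] to [1 - c] must
    contain [c], and [1 - c] is not [c] because [c] kills it. *)
Lemma center_corner x : c * x = 0 \/ c * x = c.
Proof.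
have [->|/eqP cx0] := eqVneq (c * x) 0; [by left|right].
have cxd : c * x * (1 - c) = 0 by rewrite -mulrA -dC mulrA cd mul0r.
have cx_neq : c * x <> 1 - c.
  by move=> E; apply: cx0; rewrite -cc -mulrA E cd.
have [|//|E] := @hc (c * x) (1 - c).
  by apply: gzd_adj_orthogonal => //; rewrite ds.
by case: c0; rewrite -cc -{2}E cd.
Qed.

Lemma cocorner_val (x : corner cocentral) : c * val x = 0.
Proof. by rewrite -cornerP mulrA cd mul0r. Qed.

(** If [x * y = 0] with both factors non-zero, then [x] and [star y] are orthogonal vertices, both
    killed by [c] and so different from [c]. *)
Lemma cocorner_domain : integral_domain (corner cocentral).
Proof.
move=> x y /(congr1 val); rewrite val_cornerM [RHS]/= => xy.
have [x0|/eqP x0] := eqVneq (val x) 0; first by left; apply: val_inj.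
have [y0|/eqP y0] := eqVneq (val y) 0; first by right; apply: val_inj.
have not_c (z : corner cocentral) : val z <> c.
  by move=> E; apply: c0; rewrite -cc -{2}E cocorner_val.
have csy : c * star (val y) = 0.
  by rewrite cC -{1}cs -(starM hstar) cocorner_val (star0 hstar).
(* Equal vertices span no edge; in that case [x * y] is [star y * star (star y)], and properness
   applies. *)
case: (pselect (val x = star (val y))) => [E|xNy].
  case: y0; apply: (star_eq0 hstar); apply: hproper.
  by rewrite (starK hstar) -E.
have [|/not_c//|E] := @hc (val x) (star (val y)).
- apply: gzd_adj_orthogonal => //; first by move/(star_eq0 hstar).
  by rewrite (starK hstar).
- by case: c0; rewrite -cc -{2}E csy.
Qed.

(** Projecting back gives an element of the corner without a prior proof that [star] preserves it;
    the next lemma shows that the projection changes nothing. *)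
Definition cocorner_star (x : corner cocentral) : corner cocentral :=
  corner_proj cocentral (star (val x)).

Lemma val_cocorner_star x : val (cocorner_star x) = star (val x).
Proof.
by rewrite val_corner_proj -[val x]cornerP /= (starM hstar) ds dC -mulrA dd.
Qed.

Lemma cocorner_star_ring : star_ring cocorner_star.
Proof.
split=> [x y|x y|x]; apply: val_inj.
- by rewrite val_cornerD !val_cocorner_star val_cornerD (starD hstar).
- by rewrite val_cornerM !val_cocorner_star val_cornerM (starM hstar).
- by rewrite !val_cocorner_star (starK hstar).
Qed.

(** The first coordinate identifies [c R], whose only elements are [0] and [c], with ['Z_2]; it is a
    morphism only thanks to [center_corner]. *)
Definition decomp (x : R) : 'Z_2 * corner cocentral :=
  ((c * x != 0)%:R, corner_proj cocentral x).

(** Apply the dichotomy to the element [1 + 1]: the alternative [c + c = c] would force [c = 0]. *)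
Lemma center_addcc : c + c = 0.
Proof.
have := center_corner (1 + 1); rewrite mulrDr mulr1 => -[//|E].
by case: c0; apply: (addrI c); rewrite E addr0.
Qed.

Fact decomp_zmod_morphism : zmod_morphism decomp.
Proof.
have c0b : (c != 0) by apply/eqP.
have cN : - c = c by apply/esym/eqP; rewrite -addr_eq0 center_addcc.
move=> x y; congr pair; last exact: corner_projB.
change ((c * (x - y) != 0)%:R = (c * x != 0)%:R - (c * y != 0)%:R :> 'Z_2).
rewrite mulrBr; case: (center_corner x) => ->; case: (center_corner y) => ->;
  rewrite ?subrr ?subr0 ?sub0r ?cN ?eqxx ?c0b //; exact: val_inj.
Qed.

Fact decomp_monoid_morphism : monoid_morphism decomp.
Proof.
have c0b : (c != 0) by apply/eqP.
split=> [|x y].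
  by rewrite /decomp mulr1 c0b.
congr pair; last exact: corner_projM.
change ((c * (x * y) != 0)%:R = (c * x != 0)%:R * (c * y != 0)%:R :> 'Z_2).
rewrite mulrA.
case: (center_corner x) => ->; first by rewrite !mul0r eqxx mul0r.
by rewrite c0b mul1r.
Qed.

HB.instance Definition _ := GRing.isZmodMorphism.Build _ _ decomp
  decomp_zmod_morphism.
HB.instance Definition _ := GRing.isMonoidMorphism.Build _ _ decomp
  decomp_monoid_morphism.

Definition decomp_rmorphism : {rmorphism R -> 'Z_2 * corner cocentral} :=
  decomp.

Lemma decomp_bij : bijective decomp.
Proof.
have c0b : (c != 0) by apply/eqP.
(* The inverse reassembles the Peirce decomposition of [x] as [c * x] plus [(1 - c) * x], reading
   the residue as the integer 0 or 1. *)
exists (fun p : 'Z_2 * corner cocentral => c *+ (p.1 : nat) + val p.2)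
  => [x|[i z]].
  rewrite [val _]val_corner_proj mulrBl mul1r /=.
  case: (center_corner x) => ->; rewrite ?eqxx ?c0b /=.
    by rewrite subr0 add0r.
  by rewrite mulr1n addrC subrK.
congr pair.
  rewrite mulrDr cocorner_val addr0 mulrnAr cc.
  case: i => -[|[|//]] i_lt; apply: val_inj.
    by rewrite /= mulr0n eqxx.
  by rewrite /= mulr1n c0b.
apply: val_inj; rewrite val_corner_proj mulrDr cornerP mulrnAr /=.
by rewrite dC cd mul0rn add0r.
Qed.

Lemma decomp_star : {morph decomp : x / star x >->
  prod_star (@id 'Z_2) cocorner_star x}.
Proof.
move=> x; congr pair; last first.
  apply: val_inj; rewrite val_cocorner_star !val_corner_proj (starM hstar) ds.
  exact: dC.
change ((c * star x != 0)%:R = (c * x != 0)%:R :> 'Z_2).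
have -> : c * star x = star (c * x) by rewrite (starM hstar) cs cC.
by case: (center_corner x) => ->; rewrite ?(star0 hstar) ?cs.
Qed.

End Decomposition.
End StarGraph.

(** * The converse: the graph of a product of ['Z_2] and a domain *)

Lemma Z2_cases (i : 'Z_2) : i = 0 \/ i = 1.
Proof. by case: i => -[|[|//]] ?; [left|right]; apply: val_inj. Qed.

(** The center corresponds to [(1, 0)] and the other vertices to pairs [(0, d)] with [d] non-zero;
    such pairs are orthogonal to the center but never joined to each other. *)
Lemma star_graph_Z2_domain (D : nzRingType) (starD : D -> D)
    (R : pzRingType) (star : R -> R) :
  star_ring star -> star_ring starD -> integral_domain D ->
  @star_isomorphic R ('Z_2 * D)%type star (prod_star (@id 'Z_2) starD) ->
  star_graph (gzd_graph star).
Proof.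
move=> hstar hsD hD [f [[g fK gK] fstar]].
have f_inj : injective f := can_inj fK.
have f0 x : f x = (0, 0) -> x = 0 by move=> E; apply: f_inj; rewrite E rmorph0.
pose c := g (1, 0).
have fc : f c = (1, 0) by rewrite gK.
have c0 : c <> 0 by move=> E; move: fc; rewrite E rmorph0 => -[].
have vertexP x : nonzero_zero_divisors x -> x <> c ->
    exists2 d, f x = (0, d) & d <> 0.
  move=> [x0 xZ] xc; case E: (f x) => [i d].
  case: (Z2_cases i) => i_eq; subst i.
    by exists d => // d0; apply: x0; apply: f0; rewrite E d0.
  (* When [f x = (1, d)], an annihilator of [x] on either side has first coordinate 0, hence a
     non-zero second coordinate, which forces [d = 0] in the domain. *)
  have killed_by_d y : y <> 0 -> (f x).1 * (f y).1 = 0 ->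
      (f x).2 * (f y).2 = 0 \/ (f y).2 * (f x).2 = 0 -> d = 0.
    rewrite E; case Ey: (f y) => [j d'] /= y0; rewrite mul1r => j0.
    have d'0 : d' <> 0 by move=> d'0; apply: y0; apply: f0; rewrite Ey j0 d'0.
    by case=> /hD [].
  case: xc; apply: f_inj; rewrite fc E; congr pair.
  case: xZ => -[y [y0 xy]]; apply: (killed_by_d y y0).
  - by have := congr1 (fst \o f) xy; rewrite /= rmorphM rmorph0.
  - by left; have := congr1 (snd \o f) xy; rewrite /= rmorphM rmorph0.
  - by have := congr1 (fst \o f) xy; rewrite /= rmorphM rmorph0 mulrC.
  - by right; have := congr1 (snd \o f) xy; rewrite /= rmorphM rmorph0.
exists c; split.
- split=> //; left; exists (g (0, 1)); split.
    move=> E; have := gK (0, 1); rewrite E rmorph0 => -[/esym/eqP].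
    by rewrite oner_eq0.
  apply: f0; rewrite rmorphM fc gK; congr pair; first by rewrite mulr0.
  by rewrite mul0r.
- move=> x xZ xc; have [d fx d0] := vertexP x xZ xc.
  apply: gzd_adj_orthogonal => //; [by case: xZ|by move/esym|].
  apply: f0; rewrite rmorphM fc fstar fx; congr pair; first by rewrite mulr0.
  by rewrite mul0r.
(* The second coordinate is [d ^+ n * starD d'], non-zero in a domain; the induction on [n] starts
   at exponent 0, where only [starD d'] remains. *)
- have no_edge x y d d' n : f x = (0, d) -> d <> 0 -> f y = (0, d') ->
      d' <> 0 -> x ^+ n * star y <> 0.
    move=> fx d0 fy d'0 /(congr1 (snd \o f)).
    rewrite /= rmorphM rmorphXn rmorph0 fstar fy /=.
    have -> : (f x ^+ n).2 = d ^+ n.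
      by rewrite -[LHS]/(snd (f x ^+ n)) (rmorphXn snd) fx.
    elim: n => [|n IHn]; first by rewrite mul1r => /(star_eq0 hsD).
    by rewrite exprS -mulrA => /hD [].
  move=> x y [xZ yZ _ [n [_ h]]].
  have [->|/eqP xc] := eqVneq x c; first by left.
  have [->|/eqP yc] := eqVneq y c; first by right.
  have [d fx d0] := vertexP x xZ xc; have [d' fy d'0] := vertexP y yZ yc.
  case: h => h; first by case: (no_edge _ _ _ _ n fx d0 fy d'0 h).
  by case: (no_edge _ _ _ _ n fy d'0 fx d0 h).
Qed.

Theorem theorem3p4 (R : pzRingType) (star : R -> R)
  (hstar : star_ring star)
  (habelian : abelian_star star)
  (hartinian : artinian R)
  (hproper : proper_star star)
  (hthree : at_least_three_vertices (gzd_graph star)) :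
  star_graph (gzd_graph star) <->
  exists (D : nzRingType) (starD : D -> D),
    [/\ star_ring starD, integral_domain D
      & @star_isomorphic R ('Z_2 * D)%type star (prod_star (@id 'Z_2) starD)].
Proof.
split=> [hG|[D [sD [hs hD hI]]]]; last first.
  exact: (star_graph_Z2_domain hstar hs hD hI).
have [c [cP c0 d0 hc]] :=
  star_graph_center_projection hstar hproper habelian hartinian hG.
have cC := habelian c cP.
exists (corner (cocentral hstar cP d0 cC)).
exists (@cocorner_star _ _ hstar c cP d0 cC).
split; first exact: cocorner_star_ring.
- exact: cocorner_domain.
- exists (decomp_rmorphism hstar cP c0 d0 cC hc); split.
  + exact: decomp_bij.
  + exact: decomp_star.
Qed.
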